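(* Let $\mathcal C$ be a graph class. For each positive integer $s$ let $\alpha(s)=\max\{\rho_1(H):H\in\mathcal C,\ |V(H)|=s\}$, and for each positive integer $t$ let $\beta(t)=\max\{\sigma_1(A(G)-I_{vv}):G\in\mathcal C,\ |V(G)|=t,\ v\in V(G)\}$. Let $n$ be even. Assume that $\beta(t)>\alpha(s)$ for all positive integers $s<t$. Suppose that the value $\beta(\frac n2)$ is attained by a unique pair $(G^*(\frac n2),u^* )$, up to isomorphism. Let $x$ be the positive eigenvector corresponding to $\sigma_1(A(G^*(\frac n2))-I_{u^*u^*})$. Then $x_{u^*}=\min_{v\in V(G^*(\frac n2))}x_v$. Moreover, for every connected graph $G\in\mathcal C$ of order $n$, we have $$\rho_2(G)\le\beta\left(\tfrac n2\right).$$ Equality holds if and only if $G\cong 2G^*(\frac n2)+u_1u_2$, where $2G^*(\frac n2)+u_1u_2\in\mathcal C$ and $u_i$ is the copy of $u^*$ in the $i$-th copy of $G^*(\frac n2)$ for $i=1,2$.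
   Context: All graphs are finite, simple and undirected. For a graph $G$ with adjacency matrix $A(G)$, $\rho_1(G)\ge\rho_2(G)\ge\cdots$ are the eigenvalues of $A(G)$. For a real symmetric matrix $M$, $\sigma_1(M)$ is its largest eigenvalue. For a vertex $u$ of $G$, $I_{uu}$ is the diagonal matrix indexed by $V(G)$ whose only nonzero entry is the $(u,u)$-entry, which equals $1$. Pairs $(G,u)$ and $(G',u')$ with $u\in V(G)$, $u'\in V(G')$ are isomorphic if there is a graph isomorphism $G\to G'$ mapping $u$ to $u'$. $2H+u_1u_2$ denotes the graph obtained from the disjoint union of two copies of $H$ by adding the edge $u_1u_2$, where $u_i$ is a vertex of the $i$-th copy.
   Formalization: The graph class is assumed closed under isomorphism and under connected induced subgraphs; for an arbitrary class the claim fails (e.g. all paths, the graph 2K_3+e of order 6, and all K_t with t at least 7, with n=6). *)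

(* Defs.v *)
From HB Require Import structures.
From mathcomp Require Import all_boot all_order all_algebra.
From mathcomp Require Import classical_sets reals.
From mathcomp Require Import polyrcf.

Set Implicit Arguments.
Unset Strict Implicit.
Unset Printing Implicit Defensive.

Import Order.TTheory GRing.Theory Num.Theory.

Local Open Scope ring_scope.

Record sgraph := SGraph {
  vertex :> finType;
  adj : rel vertex;
  adj_sym : symmetric adj;
  adj_irr : irreflexive adj }.

(* The null graph is not connected. *)
Definition gconnected (G : sgraph) : Prop :=
  (0 < #|G|)%N /\ forall x y : G, connect (@adj G) x y.

Definition graph_iso (G H : sgraph) (f : G -> H) : Prop :=
  bijective f /\ forall x y : G, adj (f x) (f y) = adj x y.

Definition isomorphic (G H : sgraph) : Prop := exists f : G -> H, graph_iso f.

Definition rooted_isomorphic (G : sgraph) (u : G) (H : sgraph) (w : H) : Prop :=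
  exists f : G -> H, graph_iso f /\ f u = w.

Section Induced.
Variables (G : sgraph) (S : {set G}).

Definition induced_adj : rel {x : G | x \in S} :=
  fun x y => adj (val x) (val y).

Fact induced_sym : symmetric induced_adj.
Proof. by move=> x y; rewrite /induced_adj adj_sym. Qed.

Fact induced_irr : irreflexive induced_adj.
Proof. by move=> x; rewrite /induced_adj adj_irr. Qed.

Definition induced : sgraph := SGraph induced_sym induced_irr.
End Induced.

(* A property of graphs that is invariant under isomorphism and inherited by
   connected induced subgraphs.  Every hereditary (in particular every
   monotone or minor-closed) class qualifies, and so do classes consisting of
   connected graphs only, such as trees. *)
Definition graph_class (C : sgraph -> Prop) : Prop :=
  (forall G H : sgraph, isomorphic G H -> C G -> C H) /\
  (forall (G : sgraph) (S : {set G}),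
      C G -> gconnected (induced S) -> C (induced S)).

Section TwoCopies.
Variables (H : sgraph) (u1 u2 : H).

Definition two_copies_adj : rel (H + H)%type := fun x y =>
  match x, y with
  | inl a, inl b => adj a b
  | inr a, inr b => adj a b
  | inl a, inr b => (a == u1) && (b == u2)
  | inr b, inl a => (a == u1) && (b == u2)
  end.

Fact two_copies_sym : symmetric two_copies_adj.
Proof. by case=> a [] b //=; rewrite adj_sym. Qed.

Fact two_copies_irr : irreflexive two_copies_adj.
Proof. by case=> a /=; rewrite adj_irr. Qed.

(* The graph 2H + u1u2, with u1 taken in the first copy and u2 in the second. *)
Definition two_copies_plus_edge : sgraph := SGraph two_copies_sym two_copies_irr.
End TwoCopies.

Section Spectra.
Variable R : realType.

(* The real roots of the characteristic polynomial in nonincreasing order,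
   repeated according to multiplicity. For symmetric M there are n of them. *)
Definition spectrum n (M : 'M[R]_n) : seq R :=
  flatten [seq nseq (mup x (char_poly M)) x | x <- rev (rootsR (char_poly M))].

Definition sigma1 n (M : 'M[R]_n) : R := nth 0 (spectrum M) 0.

(* Rows and columns are indexed by V(G) through enum_val / enum_rank. *)
Definition adjmx (G : sgraph) : 'M[R]_#|G| :=
  \matrix_(i, j) (adj (enum_val i) (enum_val j))%:R.

Definition vertex_mx (G : sgraph) (u : G) : 'M[R]_#|G| :=
  delta_mx (enum_rank u) (enum_rank u).

(* rho k G is the k-th largest eigenvalue, counting from k = 1. *)
Definition rho (k : nat) (G : sgraph) : R := nth 0 (spectrum (adjmx G)) k.-1.

Definition positive_eigenvector n (M : 'M[R]_n) (a : R) (x : 'cV[R]_n) : Prop :=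
  M *m x = a *: x /\ forall i, 0 < x i 0.

Definition is_max (A : set R) (m : R) : Prop := A m /\ ubound A m.

Definition is_alpha (C : sgraph -> Prop) (s : nat) (a : R) : Prop :=
  is_max [set r | exists H : sgraph, [/\ C H, #|H| = s & r = rho 1 H]] a.

Definition is_beta (C : sgraph -> Prop) (t : nat) (b : R) : Prop :=
  is_max [set r | exists (G : sgraph) (v : G),
            [/\ C G, #|G| = t & r = sigma1 (adjmx G - vertex_mx v)]] b.
End Spectra.

(* Main.v *)
(* Write m = n/2. A component K of the positive vertices of an eigenvector z of
   A(G) for the eigenvalue l satisfies l <= rho_1(G[K]), so l >= beta(m) and
   alpha(s) < beta(m) for s < m force |K| >= m. The same holds for the negative
   vertices. When z takes both signs, V(G) is therefore the disjoint union of a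
   positive part K and a negative part L, both connected of order m. Across an
   edge vw between them, say with z_v <= -z_w, testing A(G[K]) - I_vv against
   the restriction of z to K gives l <= sigma_1(A(G[K]) - I_vv) <= beta(m), with
   equality only if vw is the only crossing edge and z_v = -z_w; then the same
   test applies to L and w. A connected graph always has a mixed-sign
   eigenvector for one of its two largest eigenvalues: an eigenvector for rho_1
   of constant sign has no zero entry, and the next one is orthogonal to it. *)
Require Import Defs.
From HB Require Import structures.
From mathcomp Require Import all_boot all_order all_algebra.
From mathcomp Require Import perm.
From mathcomp Require Import reals.
From mathcomp Require Import polyrcf complex.
From mathcomp Require Import zify ring lra.
Import Order.TTheory GRing.Theory Num.Theory.
Local Open Scope ring_scope.

Set Implicit Arguments.
Unset Strict Implicit.
Unset Printing Implicit Defensive.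


(** * Orthogonal diagonalization of real symmetric matrices, and its link with [spectrum] *)

Section SymmetricMatrices.
Variable R : realType.

(** Over the complex numbers [M] is Hermitian, so its spectral diagonal is real. A diagonal entry is
    then a real root of the characteristic polynomial, hence an eigenvalue of [M] over [R] as
    well. *)
Lemma symmetric_eigenvector n (M : 'M[R]_n.+1) : M^T = M ->
  exists (a : R) (v : 'rV[R]_n.+1), v != 0 /\ v *m M = a *: v.
Proof.
move=> symM; pose MC : 'M[R[i]]_n.+1 := map_mx (real_complex R) M.
have hermM : MC \is hermsymmx.
  apply: realsym_hermsym.
    by apply/is_hermitianmxP; rewrite expr0 scale1r map_mx_id // /MC map_trmx symM.
  by apply/mxOverP => i j; rewrite mxE complex_real.
have := hermitian_spectral_diag_real hermM => /mxOverP dreal.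
have /orthomx_spectralP MCE := hermitian_normalmx hermM.
set P := spectralmx MC in MCE; set d := spectral_diag MC in MCE dreal.
have Punit : P \in unitmx by exact: spectral_unit.
have eigMC : eigenvalue MC (d 0 0).
  apply/eigenvalueP; exists (row 0 P).
    by rewrite -row_mul {1}MCE !mulmxA mulmxV // mul1mx row_mul row_diag_mx
      -scalemxAl -rowE.
  apply: contraL Punit => /eqP P0.
  rewrite unitmxE (expand_det_row P 0) big1 ?unitr0 // => j _.
  by have /rowP/(_ j) := P0; rewrite !mxE => ->; rewrite mul0r.
have /complex_realP[a aE] := dreal 0 0.
move: eigMC; rewrite aE eigenvalue_root_char /MC -map_char_poly fmorph_root.
by rewrite -eigenvalue_root_char => /eigenvalueP[v vE v0]; exists a, v.
Qed.

(** For [v] different from the first basis vector [e], the reflection in the hyperplane orthogonal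
    to [w = v - e] exchanges the unit vectors [e] and [v]. *)
Lemma householder n (v : 'rV[R]_n.+1) : v *m v^T = 1%:M ->
  exists H : 'M[R]_n.+1, [/\ H^T = H, H *m H = 1%:M & delta_mx 0 0 *m H = v].
Proof.
move=> vv; set e : 'rV[R]_n.+1 := delta_mx 0 0.
have ee : e *m e^T = 1%:M.
  by apply/rowP=> i; rewrite ord1 trmx_delta mul_delta_mx !mxE !eqxx.
have [->|nev] := eqVneq v e.
  by exists 1%:M; rewrite trmx1 !mulmx1.
pose w := v - e; pose c := (v *m e^T) 0 0.
have ve : v *m e^T = c%:M by rewrite [LHS]mx11_scalar.
have ev : e *m v^T = c%:M.
  by apply: trmx_inj; rewrite trmx_mul trmxK ve tr_scalar_mx.
(* This is the squared norm of [w], since [e] and [v] are unit vectors with inner product [c]; it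
   vanishes only if [v = e]. *)
pose q := 2 * (1 - c).
have wwE : w *m w^T = q%:M.
  rewrite /w linearB /= mulmxBr !mulmxBl vv ee ve ev.
  by apply/rowP=> i; rewrite ord1 !mxE !eqxx !mulr1n /q; ring.
have q0 : q != 0.
  apply: contra nev => /eqP q0; move/(congr1 (fun A : 'M_1 => A 0 0)): wwE.
  rewrite !mxE q0 mul0rn => /eqP.
  under eq_bigr do rewrite [w^T _ _]mxE -expr2.
  rewrite psumr_eq0 => [/allP w0|i _]; last exact: sqr_ge0.
  rewrite -subr_eq0; apply/eqP/rowP => i.
  by have := w0 i; rewrite mem_index_enum sqrf_eq0 => /(_ isT)/eqP ->; rewrite mxE.
exists (1%:M - (2 / q) *: (w^T *m w)); split.
- by rewrite linearB linearZ /= trmx1 trmx_mul trmxK.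
- rewrite mulmxBr mulmx1 mulmxBl mul1mx -scalemxAl -scalemxAr scalerA.
  rewrite mulmxA -(mulmxA w^T) wwE mul_mx_scalar -scalemxAl scalerA.
  rewrite -[X in _ - (X - _)]/((2 / q) *: _) -scalerBl.
  have -> : 2 / q - 2 / q * (2 / q) * q = - (2 / q) by field.
  by rewrite scaleNr opprK subrK.
- rewrite mulmxBr mulmx1 -scalemxAr mulmxA.
  have -> : e *m w^T = (c - 1)%:M by rewrite /w linearB /= mulmxBr ev ee raddfB.
  rewrite mul_scalar_mx scalerA.
  have -> : 2 / q * (c - 1) = -1.
    by move: q0; rewrite /q mulf_eq0 negb_or => /andP[_ ?]; field.
  by rewrite scaleN1r opprK /w addrC subrK.
Qed.

(** Conjugation by a reflection that takes [e] to a unit eigenvector clears the first row, and by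
    symmetry the first column, off the diagonal. The induction hypothesis applies to the remaining
    symmetric block. The rows of [O] are the eigenvectors. *)
Theorem symmetric_diagonalization n (M : 'M[R]_n) : M^T = M ->
  exists (O : 'M[R]_n) (d : 'rV[R]_n),
    O *m O^T = 1%:M /\ O *m M = diag_mx d *m O.
Proof.
elim: n M => [|n IH] M symM.
  by exists 1%:M, 0; split; apply/matrixP=> -[].
have [a [v0 [v0n0 v0M]]] := symmetric_eigenvector symM.
pose s := (v0 *m v0^T) 0 0.
have s0 : 0 < s.
  rewrite lt_def; apply/andP; split; rewrite /s mxE;
    under eq_bigr do rewrite mxE -expr2.
    apply: contra v0n0; rewrite psumr_eq0 => [/allP h|i _]; last exact: sqr_ge0.
    apply/eqP/rowP => i; have := h i.
    by rewrite mem_index_enum sqrf_eq0 => /(_ isT)/eqP ->; rewrite mxE.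
  by apply: sumr_ge0 => i _; exact: sqr_ge0.
pose v := (Num.sqrt s)^-1 *: v0.
have vv : v *m v^T = 1%:M.
  rewrite /v linearZ /= -scalemxAl -scalemxAr scalerA -invfM -expr2.
  rewrite sqr_sqrtr ?ltW // [v0 *m _]mx11_scalar -/s.
  by apply/rowP=> i; rewrite ord1 !mxE eqxx !mulr1n mulVf // gt_eqF.
have vM : v *m M = a *: v by rewrite /v -scalemxAl v0M !scalerA mulrC.
have [H [Hsym HH eH]] := householder vv.
pose N : 'M[R]_(1 + n) := H *m M *m H.
have symN : N^T = N by rewrite /N !trmx_mul symM Hsym mulmxA.
have eN : delta_mx 0 0 *m N = a *: delta_mx 0 0 :> 'rV[R]_(1 + n).
  rewrite /N !mulmxA eH vM -scalemxAl; congr (_ *: _).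
  by rewrite -eH -mulmxA HH mulmx1.
have BN (B : 'M[R]_(1 + n)) : B *m H *m M = B *m N *m H.
  by rewrite /N !mulmxA -[RHS]mulmxA HH mulmx1.
clearbody N.
have urN : ursubmx N = 0.
  apply/rowP => j; rewrite !mxE.
  have := congr1 (fun A : 'rV[R]_(1 + n) => A 0 (rshift 1 j)) eN.
  by rewrite -rowE !mxE /= mulr0 => <-; congr (N _ _); apply/val_inj.
have ulN : ulsubmx N = a%:M.
  apply/rowP => j; rewrite ord1 !mxE.
  have := congr1 (fun A : 'rV[R]_(1 + n) => A 0 0) eN.
  rewrite -rowE !mxE /= mulr1 mulr1n => <-.
  by congr (N _ _); apply/val_inj.
have dlN : dlsubmx N = 0.
  by apply: trmx_inj; rewrite trmx_dlsub symN urN trmx0.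
have symN' : (drsubmx N)^T = drsubmx N by rewrite trmx_drsub symN.
have [O' [d' [OO' OM']]] := IH _ symN'.
pose B : 'M[R]_(1 + n) := block_mx 1%:M 0 0 O'.
have BB : B *m B^T = 1%:M.
  rewrite /B tr_block_mx mulmx_block trmx1 !trmx0 !mulmx0 !mul0mx mulmx1 OO'.
  by rewrite !addr0 add0r scalar_mx_block.
pose D : 'rV[R]_(1 + n) := row_mx (a%:M : 'rV_1) d'.
have BND : B *m N = diag_mx D *m B.
  rewrite -[in LHS](submxK N) ulN urN dlN /D diag_mx_row /B !mulmx_block.
  rewrite !mulmx0 !mul0mx !mulmx1 !mul1mx !addr0 !add0r OM'; congr block_mx.
  by apply/rowP => i; rewrite !ord1 !mxE eqxx !mulr1n.
exists (B *m H), D; split.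
  by rewrite trmx_mul Hsym mulmxA -(mulmxA B) HH mulmx1.
by rewrite BN BND mulmxA.
Qed.

Lemma sorted_flatten_nseq (k : R -> nat) (s : seq R) : sorted >%R s ->
  sorted >=%R (flatten [seq nseq (k x) x | x <- s]).
Proof.
have ge_tr : transitive (>=%R : rel R) by move=> x y z yx zx; exact: le_trans zx yx.
have gt_tr : transitive (>%R : rel R) by move=> x y z yx zx; exact: lt_trans zx yx.
rewrite (sorted_pairwise ge_tr) (sorted_pairwise gt_tr).
elim: s => //= x s IH /andP[/allP xs /IH ps]; rewrite pairwise_cat ps andbT.
apply/andP; split.
  apply/allrelP => y z; rewrite mem_nseq => /andP[_ /eqP ->].
  by move=> /flatten_mapP[t /xs xt]; rewrite mem_nseq => /andP[_ /eqP ->]; exact: ltW.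
elim: (k x) => //= j ->; rewrite andbT; apply/allP => y.
by rewrite mem_nseq => /andP[_ /eqP ->]; exact: lexx.
Qed.

(** Conjugation preserves the characteristic polynomial, which is therefore the product of the
    factors ['X - y%:P] over the entries [y] of [d]. The multiplicity of a root is then its number
    of occurrences in [d]. *)
Lemma spectrum_diagonalized n (M O : 'M[R]_n) (d : 'rV[R]_n) :
  O *m O^T = 1%:M -> O *m M = diag_mx d *m O ->
  perm_eq (spectrum M) [tuple d 0 i | i < n] /\ sorted >=%R (spectrum M).
Proof.
move=> OO OM.
have Ounit : O \in unitmx by case: (mulmx1_unit OO).
have charM : char_poly M = \prod_(y <- [tuple d 0 i | i < n]) ('X - y%:P).
  have -> : char_poly M = char_poly (diag_mx d).
    have -> : M = invmx O *m diag_mx d *m O.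
      by rewrite -mulmxA -OM mulmxA mulVmx // mul1mx.
    rewrite /char_poly /char_poly_mx !map_mxM /=.
    set A := map_mx _ (diag_mx d).
    have UV : map_mx polyC (invmx O) *m map_mx polyC O = 1%:M.
      by rewrite -map_mxM mulVmx // map_mx1.
    have -> : 'X%:M - map_mx polyC (invmx O) *m A *m map_mx polyC O
       = map_mx polyC (invmx O) *m ('X%:M - A) *m map_mx polyC O.
      rewrite mulmxBr mulmxBl scalar_mxC -(mulmxA 'X%:M) UV.
      by rewrite mulmx1.
    by rewrite !det_mulmx mulrAC -det_mulmx UV det1 mul1r.
  rewrite char_poly_trig ?diag_mx_is_trig // big_tuple.
  by apply: eq_bigr => i _; rewrite tnth_mktuple mxE eqxx mulr1n.
have p0 : char_poly M != 0 by rewrite monic_neq0 // char_poly_monic.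
have rsort : sorted <%R (rootsR (char_poly M)) by exact: sorted_roots.
split.
  rewrite /spectrum charM.
  under eq_map do rewrite mu_prod_XsubC.
  rewrite -charM; apply: perm_trans (perm_count_undup _).
  apply/perm_flatten/perm_map/uniq_perm.
  - by rewrite rev_uniq; apply: sorted_uniq rsort; [exact: lt_trans|exact: ltxx].
  - exact: undup_uniq.
  move=> x; rewrite mem_rev mem_undup.
  have /(_ x) := roots_on_rootsR p0; rewrite in_itv /= => <-.
  by rewrite charM root_prod_XsubC.
by apply: sorted_flatten_nseq; rewrite rev_sorted.
Qed.
End SymmetricMatrices.

(** * Rayleigh quotients of symmetric kernels on a finite type *)

Section SymmetricKernels.
Variables (R : realType) (T : finType).
Implicit Types (f g : T -> R) (a : T -> T -> R).

Definition dot f g : R := \sum_x f x * g x.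

(** Vectors are functions on [T] and matrices are kernels, so that arguments about vertices avoid
    [enum_rank]; [kernel_mx] translates back to ordinal indices. *)
Definition kernel_app a f : T -> R := fun x => \sum_y a x y * f y.

Definition kernel_mx a : 'M[R]_#|T| := \matrix_(i, j) a (enum_val i) (enum_val j).

Lemma dotC f g : dot f g = dot g f.
Proof. by apply: eq_bigr => x _; rewrite mulrC. Qed.

Lemma dot_kernel_app a f g : (forall x y, a x y = a y x) ->
  dot (kernel_app a f) g = dot f (kernel_app a g).
Proof.
move=> symA; rewrite /dot /kernel_app.
under eq_bigr do rewrite mulr_suml.
rewrite exchange_big; apply: eq_bigr => x _; rewrite mulr_sumr.
by apply: eq_bigr => y _; rewrite symA mulrCA mulrA.
Qed.

(** The rows of the diagonalizing matrix are reordered by the permutation [p] that matches the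
    diagonal with the sorted spectrum, so that [e i] belongs to the [i]-th largest eigenvalue,
    counted from 0. *)
Lemma kernel_eigenbasis a : (forall x y, a x y = a y x) ->
  let s := nth 0 (spectrum (kernel_mx a)) in
  exists e : 'I_#|T| -> T -> R,
  [/\ forall i j, dot (e i) (e j) = (i == j)%:R,
      forall i, kernel_app a (e i) =1 (fun x => s i * e i x),
      forall f, f =1 (fun x => \sum_i dot f (e i) * e i x)
    & forall i j : 'I_#|T|, (i <= j)%N -> s j <= s i].
Proof.
move=> symA s; have symM : (kernel_mx a)^T = kernel_mx a.
  by apply/matrixP => i j; rewrite !mxE.
have [O [d [OO OM]]] := symmetric_diagonalization symM.
have [perm_s sort_s] := spectrum_diagonalized OO OM.
have [p sE] := tuple_permP perm_s.
have sp (i : 'I_#|T|) : s i = d 0 (p i).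
  by rewrite /s sE -tnth_nth !tnth_mktuple.
have size_s : size (spectrum (kernel_mx a)) = #|T| by rewrite sE size_tuple.
exists (fun i x => O (p i) (enum_rank x)); split.
- move=> i j; rewrite /dot (reindex _ (onW_bij _ (@enum_val_bij T))).
  have := congr1 (fun A : 'M_#|T| => A (p i) (p j)) OO; rewrite /= !mxE.
  rewrite (inj_eq perm_inj) => <-; apply: eq_bigr => k _.
  by rewrite enum_valK mxE.
- move=> i x; rewrite sp /kernel_app (reindex _ (onW_bij _ (@enum_val_bij T))).
  have := congr1 (fun A : 'M_#|T| => A (p i) (enum_rank x)) OM.
  rewrite /= mul_diag_mx !mxE => <-; apply: eq_bigr => k _.
  by rewrite enum_valK mxE enum_rankK symA mulrC.
- move=> f x; pose v : 'rV[R]_#|T| := \row_j f (enum_val j).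
  have := congr1 (fun A : 'M_#|T| => (v *m A) 0 (enum_rank x)) (mulmx1C OO).
  rewrite /= mulmx1 mulmxA mxE [v _ _]mxE enum_rankK => <-.
  rewrite (reindex p); last by apply: onW_bij; exact/injF_bij/perm_inj.
  apply: eq_bigr => i _; congr (_ * _).
  rewrite mxE /dot [RHS](reindex _ (onW_bij _ (@enum_val_bij T))).
  by apply: eq_bigr => k _; rewrite !mxE enum_valK.
- move=> i j ij; have ge_tr : transitive (>=%R : rel R).
    by move=> x y z yx zx; exact: le_trans zx yx.
  apply: (sorted_leq_nth ge_tr _ _ sort_s) => //; rewrite ?inE ?size_s //.
  exact: lexx.
Qed.

(** In the eigenbasis the quadratic form is the sum of [s i * dot f (e i) ^+ 2]. Bounding every
    [s i] by [s 0], or by [s 1] when the coefficient at [e0] vanishes, yields the two Rayleigh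
    bounds. *)
Lemma kernel_top a : (forall x y, a x y = a y x) -> (0 < #|T|)%N ->
  exists e0 : T -> R, 
  let s := nth 0 (spectrum (kernel_mx a)) in
  [/\ dot e0 e0 = 1, kernel_app a e0 =1 (fun x => s 0%N * e0 x),
      forall f, dot f (kernel_app a f) <= s 0%N * dot f f 
    & (1 < #|T|)%N -> exists e1 : T -> R,
      [/\ dot e0 e1 = 0, dot e1 e1 = 1,
          kernel_app a e1 =1 (fun x => s 1%N * e1 x), s 1%N <= s 0%N 
        & forall f, dot f e0 = 0 -> dot f (kernel_app a f) <= s 1%N * dot f f]].
Proof.
move=> symA T0; have [e [orth eig expand mono]] := kernel_eigenbasis symA.
set s := nth 0 _ in eig mono *.
have parseval f g : dot f g = \sum_i dot f (e i) * dot g (e i).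
  rewrite [LHS](_ : _ = \sum_x \sum_i dot f (e i) * e i x * g x).
    rewrite exchange_big; apply: eq_bigr => i _; rewrite [dot g _]dotC mulr_sumr.
    by apply: eq_bigr => x _; rewrite mulrA.
  by apply: eq_bigr => x _; rewrite {1}(expand f x) mulr_suml.
have quad f : dot f (kernel_app a f) = \sum_(i < #|T|) s i * dot f (e i) ^+ 2.
  rewrite parseval; apply: eq_bigr => i _; rewrite dot_kernel_app //.
  rewrite [dot f (kernel_app _ _)](_ : _ = s i * dot f (e i)); first by ring.
  by rewrite /dot mulr_sumr; apply: eq_bigr => x _; rewrite eig mulrCA.
have norm f : dot f f = \sum_i dot f (e i) ^+ 2.
  by rewrite parseval; apply: eq_bigr => i _; rewrite expr2.
pose i0 := Ordinal T0; exists (e i0); split.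
- by rewrite orth eqxx.
- by move=> x; rewrite eig.
- move=> f; rewrite quad norm mulr_sumr; apply: ler_sum => i _.
  by apply: ler_wpM2r; [exact: sqr_ge0|exact: (mono i0)].
move=> T1; pose i1 := Ordinal T1; exists (e i1); split.
- by rewrite orth.
- by rewrite orth eqxx.
- by move=> x; rewrite eig.
- exact: (mono i0 i1).
move=> f f0; rewrite quad norm mulr_sumr; apply: ler_sum => i _.
have [-> | ii0] := eqVneq i i0; first by rewrite f0 expr0n /= !mulr0.
apply: ler_wpM2r; [exact: sqr_ge0|apply: (mono i1)].
by rewrite lt0n; apply: contra ii0 => /eqP i_0; apply/eqP/val_inj.
Qed.
Lemma rayleigh_le a f (l : R) :
  (forall x y, a x y = a y x) -> 0 < dot f f ->
  l * dot f f <= dot f (kernel_app a f) -> l <= sigma1 (kernel_mx a).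
Proof.
move=> symA f0; have [T0|] := posnP #|T|.
  by move: f0; rewrite /dot big_pred0 ?ltxx // => x; have := card0_eq T0 x.
move=> /(kernel_top symA)[e0 [_ _ /(_ f) le _]] /le_trans/(_ le).
by rewrite ler_pM2r.
Qed.

Lemma dot_gt0 f x : f x != 0 -> 0 < dot f f.
Proof.
move=> fx; rewrite /dot (bigD1 x) //= ltr_wpDr ?sumr_ge0 // => [y _|].
  by rewrite -expr2 sqr_ge0.
by rewrite -expr2 exprn_even_gt0 /=.
Qed.

Lemma dot_neq0 f : dot f f != 0 -> exists x, f x != 0.
Proof.
move=> f0; apply/existsP; apply: contraNT f0 => /existsPn f0.
by rewrite /dot big1 // => x _; have := f0 x; rewrite negbK => /eqP ->; rewrite mulr0.
Qed.

End SymmetricKernels.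

(** * Adjacency kernels with a diagonal correction *)

Section WeightedAdjacency.
Variables (R : realType) (G : sgraph).
Implicit Types (d f z : G -> R).

(** The kernel of the adjacency matrix minus the diagonal matrix of [d]. Taking [d] to be 0 or the
    indicator of a vertex covers both matrices of the theorem. *)
Definition wadj d (x y : G) : R := (adj x y)%:R - (x == y)%:R * d x.

Definition nbr_sum f (x : G) : R := \sum_y (adj x y)%:R * f y.

Lemma wadj_sym d x y : wadj d x y = wadj d y x.
Proof. by rewrite /wadj adj_sym eq_sym; case: eqP => [->|_]; rewrite ?mul0r. Qed.

Lemma wadj_app d f x : kernel_app (wadj d) f x = nbr_sum f x - d x * f x.
Proof.
rewrite /kernel_app /wadj; under eq_bigr do rewrite mulrBl.
rewrite sumrB; congr (_ - _); rewrite (bigD1 x) //= eqxx mul1r big1 ?addr0 //.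
by move=> y; rewrite eq_sym => /negPf ->; rewrite !mul0r.
Qed.

Lemma nbr_sumN f x : nbr_sum (fun y => - f y) x = - nbr_sum f x.
Proof. by rewrite /nbr_sum -sumrN; apply: eq_bigr => y _; rewrite mulrN. Qed.

Lemma adjmxE : adjmx R G = kernel_mx (wadj (fun=> 0)).
Proof. by apply/matrixP => i j; rewrite !mxE /wadj mulr0 subr0. Qed.

Lemma adjmx_vertexE u :
  adjmx R G - vertex_mx R u = kernel_mx (wadj (fun x => (x == u)%:R)).
Proof.
apply/matrixP => i j; rewrite !mxE /wadj; congr (_ - _).
have rankE k : (k == enum_rank u) = (enum_val k == u).
  by rewrite (can2_eq enum_valK enum_rankK).
rewrite !rankE -natrM mulnb; congr (nat_of_bool _)%:R.
move: (enum_val i) (enum_val j) => x y.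
by have [->|_] := eqVneq x u; rewrite ?andbF // andbT eq_sym.
Qed.

(** At a zero of [f] the eigenvalue equation makes the neighbour sum vanish, so by nonnegativity all
    neighbours are zeros too. In a connected graph one zero would spread to every vertex. *)
Lemma eigenvector_pos d f l : gconnected G -> (forall x, 0 <= f x) ->
  (forall x, nbr_sum f x - d x * f x = l * f x) ->
  (exists x, f x != 0) -> forall x, 0 < f x.
Proof.
move=> [_ conG] f0 eig [x0 fx0] x; rewrite lt_def f0 andbT.
have zero_closed : forall x y, adj x y -> f x = 0 -> f y = 0.
  move=> y w yw fy; have /eqP := eig y; rewrite fy !mulr0 subr0.
  rewrite psumr_eq0 => [/allP/(_ w)|v _]; last by rewrite mulr_ge0 ?ler0n.
  by rewrite mem_index_enum yw mul1r => /(_ isT)/eqP.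
have cl : closed (@adj G) [pred y | f y == 0].
  move=> y w yw; rewrite !inE; apply/eqP/eqP; first exact: zero_closed.
  by apply: zero_closed; rewrite adj_sym.
by have := closed_connect cl (conG x0 x); rewrite !inE (negPf fx0) => <-.
Qed.

Lemma sum_induced (K : {set G}) (F : G -> R) :
  \sum_(x : induced K) F (val x) = \sum_(x in K) F x.
Proof. by rewrite [RHS]big_sub. Qed.

End WeightedAdjacency.

(** * Nodal domains and the estimate across a cut *)

Section NodalDomains.
Variable R : realType.

Lemma card_induced (G : sgraph) (K : {set G}) : #|induced K| = #|K|.
Proof. exact: card_sig. Qed.

Lemma nbr_sum_split (G : sgraph) (K : {set G}) (z : G -> R) (x : induced K) :
  nbr_sum (fun y : induced K => z (val y)) x =
  nbr_sum z (val x) - \sum_(y | y \notin K) (adj (val x) y)%:R * z y.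
Proof.
rewrite /nbr_sum [X in _ = X - _](bigID (mem K)) /= addrK.
exact: (sum_induced K (fun y => (adj (val x) y)%:R * z y)).
Qed.

(* K is the component of x0 in the graph induced on {z > 0}: a neighbour of K
   outside K has z <= 0, so restricting z to K can only increase the
   neighbour sums. *)
Lemma nodal_domain (G : sgraph) (d z : G -> R) (l : R) (x0 : G) :
  (forall x, 0 <= d x) -> (forall x, nbr_sum z x - d x * z x = l * z x) ->
  0 < z x0 ->
  exists K : {set G}, [/\ x0 \in K, forall x, x \in K -> 0 < z x,
    gconnected (induced K) & l <= rho R 1 (induced K)].
Proof.
move=> d0 eig z0; pose e : rel G := fun x y => [&& adj x y, 0 < z x & 0 < z y].
have symE : connect_sym e.
  by apply: sym_connect_sym => x y; rewrite /e adj_sym; congr (_ && _); exact: andbC.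
pose K := [set y | connect e x0 y].
have x0K : x0 \in K by rewrite inE connect0.
have zK x : x \in K -> 0 < z x.
  have cl : closed e [pred y | 0 < z y].
    by move=> y w /and3P[_ zy zw]; rewrite !inE zy zw.
  by rewrite inE => /(closed_connect cl); rewrite !inE z0 => <-.
have stepK x y : x \in K -> e x y -> y \in K.
  by rewrite !inE => xK xy; apply: connect_trans xK (connect1 xy).
exists K; split=> //.
  split=> [|x y]; first by rewrite card_induced; apply/card_gt0P; exists x0.
  (* An [e]-path starting in [K] stays in [K], so it lifts vertex by vertex to the induced graph. *)
  have : connect e (val x) (val y).
    have := valP x; have := valP y; rewrite !inE => ? xK.
    by apply: connect_trans (_ : connect e _ x0) _; rewrite // symE.
  case/connectP => p; elim: p x => [|w p IH] x /=.
    by move=> _ /val_inj ->; exact: connect0.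
  case/andP => xw pth lst; have wK := stepK _ _ (valP x) xw.
  apply: connect_trans (IH (Sub w wK) pth lst); apply: connect1.
  by rewrite /= /induced_adj; case/and3P: xw.
rewrite /rho adjmxE; apply: (rayleigh_le (f := fun x : induced K => z (val x))).
- exact: wadj_sym.
- by apply: (dot_gt0 (x := Sub x0 x0K : induced K)); rewrite gt_eqF.
rewrite /dot mulr_sumr; apply: ler_sum => x _.
have zx := zK _ (valP x); rewrite mulrCA ler_pM2l //.
rewrite wadj_app nbr_sum_split mul0r subr0.
rewrite -[nbr_sum _ _](subrK (d (val x) * z (val x))).
rewrite eig -addrA ler_wpDr // subr_ge0 (@le_trans _ _ 0) //; last first.
  by rewrite mulr_ge0 // ltW.
apply: sumr_le0 => y yK; have [xy|_] := boolP (adj (val x) y); last by rewrite mul0r.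
rewrite mul1r leNgt; apply: contra yK => zy.
by apply: (stepK (val x)); [exact: valP|rewrite /e xy zx zy].
Qed.

(** On the restriction [f] of [z] the quadratic form equals [l * dot f f + cross - z u ^+ 2], where
    [cross] collects the nonnegative products [- z x * z y] over the cut edges. The edge [uv] alone
    contributes at least [z u ^+ 2]. *)
Lemma cut_bound (G : sgraph) (K : {set G}) (z : G -> R) (l : R) (u v : G)
    (uK : u \in K) :
  (forall x, nbr_sum z x = l * z x) ->
  (forall x, x \in K -> 0 < z x) -> (forall x, x \notin K -> z x < 0) ->
  v \notin K -> adj u v -> z u <= - z v ->
  let s := sigma1 (adjmx R (induced K) - vertex_mx R (Sub u uK : induced K)) in
  l <= s /\ (s = l -> z v = - z u /\
     forall x y, x \in K -> y \notin K -> adj x y -> x = u /\ y = v).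
Proof.
move=> eig zK zNK vK uv zuv s.
pose f (x : induced K) := z (val x).
pose t (p : G * G) := (adj p.1 p.2)%:R * z p.1 * - z p.2.
pose cross := \sum_(p | (p.1 \in K) && (p.2 \notin K)) t p.
have t_ge0 p : (p.1 \in K) && (p.2 \notin K) -> 0 <= t p.
  move=> /andP[/zK p1 /zNK p2]; apply: mulr_ge0; last by rewrite oppr_ge0 ltW.
  by apply: mulr_ge0; rewrite ?ler0n // ltW.
have f0 : 0 < dot f f.
  by apply: (dot_gt0 (x := Sub u uK : induced K)); rewrite gt_eqF // zK.
pose d (x : induced K) : R := (x == Sub u uK)%:R.
have quad : dot f (kernel_app (wadj d) f) = l * dot f f + cross - z u ^+ 2.
  rewrite /dot; under eq_bigr do rewrite wadj_app nbr_sum_split eig mulrBr mulrBr.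
  rewrite !sumrB; congr (_ - _).
    rewrite mulr_sumr; congr (_ + _); first by apply: eq_bigr => x _; rewrite mulrCA.
    rewrite /cross -(pair_big (mem K) (fun y => y \notin K) (fun x y => t (x, y))) /=.
    rewrite -(sum_induced K (fun x => \sum_(y | y \notin K) t (x, y))) -sumrN.
    apply: eq_bigr => x _; rewrite mulr_sumr -sumrN; apply: eq_bigr => y _.
    by rewrite /t /= /f; ring.
  rewrite (bigD1 (Sub u uK : induced K)) //= /d eqxx mul1r big1 ?addr0 ?expr2 //.
  by move=> x /negPf ->; rewrite mul0r mulr0.
have le_s : l * dot f f + cross - z u ^+ 2 <= s * dot f f.
  rewrite -quad /s adjmx_vertexE; have K0 : (0 < #|induced K|)%N.
    by rewrite card_induced; apply/card_gt0P; exists u.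
  by have [e0 [_ _ + _]] := kernel_top (wadj_sym d) K0; exact.
have tuv : z u ^+ 2 <= t (u, v).
  by rewrite /t /= uv mul1r expr2 ler_pM2l ?zK.
have [cross_ge cross_uv] : z u ^+ 2 <= cross /\ t (u,v) <= cross.
  have : t (u, v) <= cross.
    rewrite /cross (bigD1 (u, v)) /= ?uK //; rewrite lerDl sumr_ge0 // => p.
    by case/andP => /t_ge0.
  by split=> //; apply: le_trans tuv _.
split.
  rewrite -(ler_pM2r f0); apply: le_trans le_s.
  by rewrite -addrA lerDl subr_ge0.
(* In the equality case [cross] is exactly exhausted by the edge [uv]; any further cut edge would
   add a strictly positive term. *)
move=> sl; have cross_le : cross <= z u ^+ 2.
  by move: le_s; rewrite sl -addrA gerDl subr_le0.
have zu := zK _ uK.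
split.
  apply/eqP; rewrite eq_sym eqr_oppLR eq_le zuv /=.
  have := le_trans cross_uv cross_le.
  by rewrite /t /= uv mul1r expr2 ler_pM2l.
move=> x y xK yK xy; have [[-> ->] //|neq] := eqVneq (x, y) (u, v).
suff : z u ^+ 2 < cross by rewrite ltNge cross_le.
rewrite /cross (bigD1 (u, v)) /= ?uK // (bigD1 (x, y)) /= ?xK ?yK //.
apply: le_lt_trans tuv _; rewrite ltrDl ltr_wpDr //.
  by apply: sumr_ge0 => p /andP[/andP[/t_ge0]].
by rewrite /t /= xy mul1r mulr_gt0 ?oppr_gt0 ?zK ?zNK.
Qed.
End NodalDomains.

(** * Two copies joined by an edge, and eigenvectors of mixed sign *)

Section TwoCopies.

Lemma glue_isomorphic (G H : sgraph) (h : H) (K L : {set G}) (u v : G)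
    (uK : u \in K) (vL : v \in L) :
  (forall x, (x \in L) = (x \notin K)) ->
  rooted_isomorphic (Sub u uK : induced K) h ->
  rooted_isomorphic (Sub v vL : induced L) h ->
  adj u v ->
  (forall x y, x \in K -> y \in L -> adj x y -> x = u /\ y = v) ->
  isomorphic G (two_copies_plus_edge h h).
Proof.
move=> LE [f1 [[bij1 adj1] f1u]] [f2 [[bij2 adj2] f2v]] uv only.
have [g1 f1K g1K] := bij1; have [g2 f2K g2K] := bij2.
(* The default [Sub v vL] is never reached: a vertex outside [K] lies in [L]. *)
pose f x : two_copies_plus_edge h h :=
  if insub x is Some y then inl (f1 y) else inr (f2 (insubd (Sub v vL) x)).
pose g (y : two_copies_plus_edge h h) : G :=
  match y with inl a => val (g1 a) | inr b => val (g2 b) end.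
have fK x (xK : x \in K) : f x = inl (f1 (Sub x xK)) by rewrite /f insubT.
have fL x (xL : x \in L) : f x = inr (f2 (Sub x xL)).
  by rewrite /f insubN -?LE // /insubd insubT.
have KL x : {x \in K} + {x \in L} by rewrite LE; case: (x \in K); [left|right].
exists f; split.
  exists g => [x|[a|b]].
  - by have [xK|xL] := KL x; [rewrite (fK _ xK) /= f1K|rewrite (fL _ xL) /= f2K].
  - by rewrite /g /f valK g1K.
  - by rewrite /g (fL _ (valP _)) (_ : Sub _ _ = g2 b) ?g2K //; exact: val_inj.
(* Since [f1] and [f2] are injective and send [u] and [v] to [h], the joining edge corresponds
   exactly to [uv], the only edge between [K] and [L]. *)
have cross x y (xK : x \in K) (yL : y \in L) :
    (f1 (Sub x xK) == h) && (f2 (Sub y yL) == h) = adj x y.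
  rewrite -{1}f1u (can_eq f1K) -f2v (can_eq f2K) -!val_eqE /=.
  apply/andP/idP => [[/eqP -> /eqP ->] //|/only[] // -> ->].
  by rewrite !eqxx.
move=> x y; have [xK|xL] := KL x; have [yK|yL] := KL y.
- by rewrite (fK _ xK) (fK _ yK) /= adj1.
- by rewrite (fK _ xK) (fL _ yL) /= cross.
- by rewrite (fL _ xL) (fK _ yK) /= cross adj_sym.
- by rewrite (fL _ xL) (fL _ yL) /= adj2.
Qed.

Variable R : realType.

(* Combining f on the two copies with coefficients a and c gives the quadratic
   form b (a^2 + c^2) |f|^2 + (a + c)^2 f(u)^2, so A(G) has Rayleigh quotient at
   least b on a plane, hence on a vector orthogonal to the top eigenvector. *)
Lemma second_eigenvalue_two_copies (G H : sgraph) (u : H) (f : H -> R) (b : R) :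
  isomorphic G (two_copies_plus_edge u u) -> (forall x, 0 < f x) ->
  (forall x, nbr_sum f x - (x == u)%:R * f x = b * f x) ->
  b <= rho R 2 G.
Proof.
move=> [phi [[psi phiK psiK] adj_phi]] f0 eig.
pose h (a c : R) (y : two_copies_plus_edge u u) :=
  match y with inl i => a * f i | inr i => c * f i end.
have sumG (F : G -> R) : \sum_x F x = \sum_i F (psi (inl i)) + \sum_i F (psi (inr i)).
  rewrite (reindex psi) ?big_sumType //=.
  by apply: onW_bij; exists phi.
have norm a c : dot (h a c \o phi) (h a c \o phi) = (a ^+ 2 + c ^+ 2) * dot f f.
  rewrite /dot sumG mulrDl !mulr_sumr /=; congr (_ + _);
  by apply: eq_bigr => i _; rewrite psiK /=; ring.
(* At the root, [a * f u] restores the diagonal term subtracted in [eig], and [c * f u] comes from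
   the neighbour in the other copy. *)
have nbr a c i : nbr_sum (h a c \o phi) (psi (inl i)) =
    a * (b * f i) + (i == u)%:R * ((a + c) * f u).
  rewrite /nbr_sum sumG -eig.
  under eq_bigr do rewrite -adj_phi /= !psiK /=.
  under [X in _ + X]eq_bigr do rewrite -adj_phi /= !psiK /=.
  rewrite [X in _ + X](bigD1 u) //= eqxx andbT [X in _ + (_ + X)]big1 ?addr0; last first.
    by move=> j /negPf ->; rewrite andbF mul0r.
  rewrite [X in X + _](_ : _ = a * nbr_sum f i).
    by have [->|_] := eqVneq i u; rewrite /=; ring.
  by rewrite /nbr_sum mulr_sumr; apply: eq_bigr => j _; ring.
have nbr' a c i : nbr_sum (h a c \o phi) (psi (inr i)) =
    c * (b * f i) + (i == u)%:R * ((a + c) * f u).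
  rewrite /nbr_sum sumG -eig.
  under eq_bigr do rewrite -adj_phi /= !psiK /=.
  under [X in _ + X]eq_bigr do rewrite -adj_phi /= !psiK /=.
  rewrite [X in X + _](bigD1 u) //= eqxx /= [X in _ + X + _]big1 ?addr0; last first.
    by move=> j /negPf ->; rewrite mul0r.
  rewrite [X in _ + X](_ : _ = c * nbr_sum f i).
    by have [->|_] := eqVneq i u; rewrite /=; ring.
  by rewrite /nbr_sum mulr_sumr; apply: eq_bigr => j _; ring.
have quad a c : dot (h a c \o phi) (kernel_app (wadj (fun=> 0)) (h a c \o phi))
    = b * dot (h a c \o phi) (h a c \o phi) + ((a + c) * f u) ^+ 2.
  rewrite norm {1}/dot sumG.
  under eq_bigr do rewrite wadj_app mul0r subr0 nbr /= psiK /= mulrDr.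
  under [X in _ + X]eq_bigr do rewrite wadj_app mul0r subr0 nbr' /= psiK /= mulrDr.
  rewrite !big_split /=.
  have root_sum e : \sum_i e * f i * ((i == u)%:R * ((a + c) * f u)) =
      e * f u * ((a + c) * f u).
    rewrite (bigD1 u) //= eqxx mul1r big1 ?addr0 // => i /negPf ->.
    by rewrite mul0r mulr0.
  have main_sum e : \sum_i e * f i * (e * (b * f i)) = e ^+ 2 * b * dot f f.
    by rewrite /dot mulr_sumr; apply: eq_bigr => i _; ring.
  by rewrite !root_sum !main_sum; ring.
have fu : f u != 0 by rewrite gt_eqF.
have f_norm : 0 < dot f f by exact: dot_gt0 fu.
have G1 : (1 < #|G|)%N.
  have -> : #|G| = #|two_copies_plus_edge u u| by apply: bij_eq_card; exists psi.
  by rewrite card_sum; have : (0 < #|H|)%N by [apply/card_gt0P; exists u]; lia.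
have [e0 [_ _ _ /(_ G1)[e1 [_ _ _ _ ray]]]] :=
  kernel_top (wadj_sym (fun=> 0 : R)) (ltnW G1).
(* The inner product with [e0] is the linear form [a * p + c * q]; it vanishes at [(1, 0)] if
   [p = 0] and at [(q, - p)] otherwise. *)
have [a [c [ac ort]]] : exists a c, 0 < a ^+ 2 + c ^+ 2 /\ dot (h a c \o phi) e0 = 0.
  have lin a c : dot (h a c \o phi) e0 =
      a * dot (h 1 0 \o phi) e0 + c * dot (h 0 1 \o phi) e0.
    rewrite /dot !mulr_sumr -big_split; apply: eq_bigr => x _ /=.
    by case: (phi x) => i /=; ring.
  set p := dot _ _ in lin; set q := dot (h 0 1 \o phi) e0 in lin.
  have [p0|p0] := eqVneq p 0.
    by exists 1, 0; split; rewrite ?p0 // expr1n expr0n /= addr0.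
  exists q, (- p); rewrite lin; split; last by ring.
  by rewrite sqrrN ltr_wpDl ?sqr_ge0 // exprn_even_gt0.
have := ray _ ort; rewrite quad => le.
rewrite /rho adjmxE -(ler_pM2r (_ : 0 < dot (h a c \o phi) (h a c \o phi))).
  by apply: le_trans le; rewrite lerDl sqr_ge0.
by rewrite norm mulr_gt0.
Qed.

(** If neither [e0] nor [e1] has both signs, then [e0] or its negative is a positive [w], and
    orthogonality reads as a vanishing sum of [w y] times the absolute value of [e1 y], which
    contradicts that [e1] is nonzero. *)
Lemma mixed_sign_eigenvector (G : sgraph) : gconnected G -> (1 < #|G|)%N ->
  exists (l : R) (z : G -> R), [/\ rho R 2 G <= l,
    forall x, nbr_sum z x = l * z x, exists x, 0 < z x & exists x, z x < 0].
Proof.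
move=> conG G1; have [e0 [n0 eig0 _ /(_ G1)[e1 [orth n1 eig1 le10 _]]]] :=
  kernel_top (wadj_sym (fun=> 0 : R)) (ltnW G1).
rewrite /rho adjmxE; set s := nth 0 _ in eig0 eig1 le10 *.
have app0 f x : kernel_app (wadj (fun=> 0)) f x = nbr_sum f x :> R.
  by rewrite wadj_app mul0r subr0.
have eigE0 x : nbr_sum e0 x = s 0%N * e0 x by rewrite -app0 eig0.
have eigE1 x : nbr_sum e1 x = s 1%N * e1 x by rewrite -app0 eig1.
have sgn (f : G -> R) : (exists x, 0 < f x) /\ (exists x, f x < 0) \/
    (forall x, 0 <= f x) \/ (forall x, f x <= 0).
  have [/existsP fp|/existsPn fn] := boolP [exists x, 0 < f x]; last first.
    by right; right => x; rewrite leNgt.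
  have [/existsP fm|/existsPn fm] := boolP [exists x, f x < 0]; first by left.
  by right; left => x; rewrite leNgt.
have [[p m]|same0] := sgn e0; first by exists (s 0%N), e0.
have [[p m]|same1] := sgn e1; first by exists (s 1%N), e1.
have nz : exists x, e0 x != 0 by apply: dot_neq0; rewrite n0 oner_eq0.
have [w [w0 ow]] : exists w : G -> R, (forall x, 0 < w x) /\ dot w e1 = 0.
  case: same0 => e0s.
    exists e0; split=> //; apply: (eigenvector_pos (d := fun=> 0) (l := s 0%N)) => // x.
    by rewrite mul0r subr0.
  exists (fun x => - e0 x); split; last first.
    rewrite -[RHS]oppr0 -orth /dot -sumrN; apply: eq_bigr => x _.
    by rewrite mulNr.
  apply: (eigenvector_pos (d := fun=> 0) (l := s 0%N)) => // [x|x|].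
  - by rewrite oppr_ge0.
  - by rewrite mul0r subr0 nbr_sumN eigE0 mulrN.
  - by case: nz => x x0; exists x; rewrite oppr_eq0.
have [x x1] : exists x, e1 x != 0 by apply: dot_neq0; rewrite n1 oner_eq0.
suff : e1 x = 0 by move/eqP; rewrite (negPf x1).
have {}ow : \sum_y w y * `|e1 y| = 0.
  case: same1 => e1s.
    by rewrite -[RHS]ow; apply: eq_bigr => y _; rewrite ger0_norm.
  rewrite -[RHS]oppr0 -[in RHS]ow -sumrN.
  by apply: eq_bigr => y _; rewrite ler0_norm // mulrN.
move/eqP: ow; rewrite psumr_eq0 => [/allP/(_ x)|y _].
  rewrite mem_index_enum mulf_eq0 gt_eqF //= normr_eq0 => /(_ isT)/eqP //.
by rewrite mulr_ge0 // ltW.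
Qed.
End TwoCopies.

(** * Extremal pairs in the class *)

Section ExtremalClass.
Variables (R : realType) (C : sgraph -> Prop) (alpha beta : nat -> R).
Hypothesis hC : graph_class C.
Hypothesis halpha : forall s : nat, (0 < s)%N -> is_alpha C s (alpha s).
Hypothesis hbeta : forall t : nat, (0 < t)%N -> is_beta C t (beta t).
Hypothesis hlt : forall s t : nat, (0 < s)%N -> (s < t)%N -> alpha s < beta t.

Lemma sigma1_le_beta (G : sgraph) (v : G) : C G ->
  sigma1 (adjmx R G - vertex_mx R v) <= beta #|G|.
Proof.
move=> CG; have G0 : (0 < #|G|)%N by apply/card_gt0P; exists v.
by have [_ ub] := hbeta G0; apply: ub; exists G, v.
Qed.

(** A domain [K] with fewer than [m] vertices would give [beta m <= l <= alpha #|K| < beta m]. *)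
Lemma large_nodal_domain (G : sgraph) (d z : G -> R) (l : R) (x0 : G) (m : nat) :
  C G -> (forall x, 0 <= d x) -> (forall x, nbr_sum z x - d x * z x = l * z x) ->
  0 < z x0 -> beta m <= l ->
  exists K : {set G}, [/\ forall x, x \in K -> 0 < z x, gconnected (induced K),
    C (induced K) & (m <= #|K|)%N].
Proof.
move=> CG d0 eig z0 lm; have [K [x0K zK conK lK]] := nodal_domain d0 eig z0.
have CK := hC.2 _ _ CG conK.
exists K; split=> //; rewrite leqNgt; apply/negP => Km.
have K0 : (0 < #|K|)%N by apply/card_gt0P; exists x0.
have : rho R 1 (induced K) <= alpha #|K|.
  by have [_ ub] := halpha K0; apply: ub; exists (induced K); rewrite card_induced.
by rewrite leNgt (lt_le_trans (hlt K0 Km)) // (le_trans lm).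
Qed.

Section Extremal.
Variables (m : nat) (H : sgraph) (u : H).
Hypothesis CH : C H.
Hypothesis cardH : #|H| = m.
Hypothesis maxH : sigma1 (adjmx R H - vertex_mx R u) = beta m.
Hypothesis uniqH : forall (G : sgraph) (v : G), C G -> #|G| = m ->
  sigma1 (adjmx R G - vertex_mx R v) = beta m -> rooted_isomorphic v u.

(** Positivity comes from the size bound: a positive nodal domain of a top eigenvector has at least
    [m] vertices, so it is all of [H]. The sign is fixed by passing to the negative if necessary. *)
Lemma extremal_eigenvector : exists f : H -> R, (forall x, 0 < f x) /\
  forall x, nbr_sum f x - (x == u)%:R * f x = beta m * f x.
Proof.
have H0 : (0 < #|H|)%N by apply/card_gt0P; exists u.
have [e [n1 eig _ _]] := kernel_top (wadj_sym (fun x => (x == u)%:R : R)) H0.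
rewrite -adjmx_vertexE -/(sigma1 _) maxH in eig.
have {}eig x : nbr_sum e x - (x == u)%:R * e x = beta m * e x.
  by have := eig x; rewrite wadj_app.
have all_pos (f : H -> R) x0 : 0 < f x0 ->
    (forall x, nbr_sum f x - (x == u)%:R * f x = beta m * f x) ->
    forall x, 0 < f x.
  move=> f0 fE x.
  have [K [fK _ _ mK]] := large_nodal_domain CH (fun x => ler0n _ _) fE f0 (lexx _).
  apply: fK; suff /eqP -> : K == setT by rewrite inE.
  by rewrite eqEcard subsetT cardsT cardH.
have [x x0] : exists x, e x != 0 by apply: dot_neq0; rewrite n1 oner_eq0.
have [ep|en|e0] := ltgtP 0 (e x); last by rewrite -e0 eqxx in x0.
  by exists e; split=> //; exact: all_pos ep eig.
have eigN y : nbr_sum (fun x => - e x) y - (y == u)%:R * - e y = beta m * - e y.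
  by rewrite nbr_sumN !mulrN -eig opprB opprK addrC.
exists (fun x => - e x); split=> //; apply: (all_pos _ x) => //.
by rewrite oppr_gt0.
Qed.

(** Moving the root from [u] to [v] changes the quadratic form at [x] by [f u ^+ 2 - f v ^+ 2]. A
    positive change would push the Rayleigh quotient above [beta m]. *)
Lemma extremal_root_min (x : 'cV[R]_#|H|) (M := adjmx R H - vertex_mx R u) :
  positive_eigenvector M (sigma1 M) x ->
  forall v : H, x (enum_rank u) 0 <= x (enum_rank v) 0.
Proof.
move=> [Mx x0] v; pose f y : R := x (enum_rank y) 0.
have H0 : (0 < #|H|)%N by apply/card_gt0P; exists u.
pose d w (y : H) : R := (y == w)%:R.
have eig y : kernel_app (wadj (d u)) f y = beta m * f y.
  have := congr1 (fun A : 'cV_#|H| => A (enum_rank y) 0) Mx.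
  rewrite /M maxH adjmx_vertexE !mxE => <-.
  rewrite /kernel_app (reindex _ (onW_bij _ (@enum_val_bij H))).
  by apply: eq_bigr => i _; rewrite !mxE /f enum_valK enum_rankK.
have quad w : dot f (kernel_app (wadj (d w)) f) = dot f (nbr_sum f) - f w ^+ 2.
  rewrite /dot; under eq_bigr do rewrite wadj_app mulrBr.
  rewrite sumrB; congr (_ - _); rewrite (bigD1 w) //= /d eqxx mul1r big1 ?addr0 //.
  by move=> y /negPf ->; rewrite mul0r mulr0.
have [e [_ _ /(_ f) le _]] := kernel_top (wadj_sym (d v)) H0.
rewrite -adjmx_vertexE -/(sigma1 _) in le.
have f0 : 0 < dot f f by apply: (@dot_gt0 _ _ f u); rewrite gt_eqF ?x0.
have : dot f (kernel_app (wadj (d v)) f) <= dot f (kernel_app (wadj (d u)) f).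
  apply: le_trans le _.
  rewrite (_ : dot f (kernel_app (wadj (d u)) f) = beta m * dot f f).
    by rewrite ler_pM2r // -cardH sigma1_le_beta.
  by rewrite /dot mulr_sumr; apply: eq_bigr => y _; rewrite eig mulrCA.
by rewrite !quad lerD2l lerN2 ler_sqr // nnegrE; apply/ltW/x0.
Qed.

(** The cut estimate on [K] squeezes [l] to [beta m]. Equality gives [z w = - z v], which is what
    the same estimate needs for [- z], [L] and [w]. Uniqueness then identifies both rooted halves
    with the pair of [H] and [u]. *)
Lemma extremal_cut (G : sgraph) (K L : {set G}) (z : G -> R) (l : R) (v w : G) :
  (forall x, (x \in L) = (x \notin K)) ->
  C (induced K) -> C (induced L) -> #|K| = m -> #|L| = m ->
  (forall x, nbr_sum z x = l * z x) ->
  (forall x, x \in K -> 0 < z x) -> (forall x, x \in L -> z x < 0) ->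
  v \in K -> w \in L -> adj v w -> z v <= - z w -> beta m <= l ->
  l = beta m /\ isomorphic G (two_copies_plus_edge u u).
Proof.
move=> LE CK CL cK cL eig zK zL vK wL vw zvw lm.
have zNK x : x \notin K -> z x < 0 by rewrite -LE; exact: zL.
have wK : w \notin K by rewrite -LE.
have [] := cut_bound vK eig zK zNK wK vw zvw; set s := sigma1 _ => ls.
have sb : s <= beta m by rewrite -cK -card_induced; exact: sigma1_le_beta.
have lE : l = beta m by apply: le_anti; rewrite lm (le_trans ls).
have sl : s = l by apply: le_anti; rewrite ls lE sb.
move=> /(_ sl)[zwv only].
have eigN x : nbr_sum (fun y => - z y) x = l * - z x by rewrite nbr_sumN eig mulrN.
have zL' x : x \in L -> 0 < - z x by move=> /zL; rewrite oppr_gt0.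
have zNL x : x \notin L -> - z x < 0 by rewrite LE negbK oppr_lt0; exact: zK.
have vL : v \notin L by rewrite LE negbK.
have wv : adj w v by rewrite adj_sym.
have zwv' : - z w <= - - z v by rewrite zwv opprK.
have [] := cut_bound wL eigN zL' zNL vL wv zwv'; set s' := sigma1 _ => ls' _.
have sb' : s' <= beta m by rewrite -cL -card_induced; exact: sigma1_le_beta.
split=> //; apply: (glue_isomorphic (uK := vK) (vL := wL) LE) => //.
- by apply: uniqH; rewrite ?card_induced // -/s sl.
- apply: uniqH; rewrite ?card_induced // -/s'.
  by apply: le_anti; rewrite sb' -lE ls'.
- by move=> x y xK; rewrite LE; exact: only.
Qed.

(** A positive and a negative nodal domain are disjoint and have at least [m] vertices each, so they
    partition the [m + m] vertices. *)
Lemma extremal_mixed_sign (G : sgraph) (z : G -> R) (l : R) :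
  C G -> gconnected G -> #|G| = (m + m)%N ->
  (forall x, nbr_sum z x = l * z x) ->
  (exists x, 0 < z x) -> (exists x, z x < 0) -> beta m <= l ->
  l = beta m /\ isomorphic G (two_copies_plus_edge u u).
Proof.
move=> CG [_ conG] cG eig [p zp] [q zq] lm.
have eig0 x : nbr_sum z x - 0 * z x = l * z x by rewrite mul0r subr0.
have eigN x : nbr_sum (fun y => - z y) x = l * - z x by rewrite nbr_sumN eig mulrN.
have eigN0 x : nbr_sum (fun y => - z y) x - 0 * - z x = l * - z x.
  by rewrite mul0r subr0.
have zq' : 0 < - z q by rewrite oppr_gt0.
have zero_ge0 (x : G) : 0 <= (0 : R) by [].
have [K [zK conK CK mK]] := large_nodal_domain CG zero_ge0 eig0 zp lm.
have [L [zL conL CL mL]] := large_nodal_domain CG zero_ge0 eigN0 zq' lm.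
have LsubK : L \subset ~: K.
  apply/subsetP => x xL; rewrite inE; apply/negP => /zK zx.
  by have := zL x xL; rewrite oppr_gt0 ltNge (ltW zx).
have cKC : (#|K| + #|~: K| = m + m)%N by rewrite cardsC cG.
have LK : L = ~: K by apply/eqP; rewrite eqEcard LsubK; lia.
have cL : #|L| = m by rewrite LK in mL *; lia.
have cK : #|K| = m by rewrite LK in cL; lia.
have LE x : (x \in L) = (x \notin K) by rewrite LK inE.
have zL' x : x \in L -> z x < 0 by move=> /zL; rewrite oppr_gt0.
have [x [y [xK yL xy]]] : exists x y, [/\ x \in K, y \in L & adj x y].
  have m0 : (0 < m)%N by rewrite -cardH; apply/card_gt0P; exists u.
  have /card_gt0P[x xK] : (0 < #|K|)%N by rewrite cK.
  have /card_gt0P[y yL] : (0 < #|L|)%N by rewrite cL.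
  have [/existsP[v /existsP[w /and3P[vK wL vw]]]|none] :=
    boolP [exists v, exists w, [&& v \in K, w \in L & adj v w]]; first by exists v, w.
  (* Without a crossing edge [K] would be closed under adjacency, against connectivity. *)
  have cl : closed (@adj G) (mem K).
    apply: intro_closed => [|v w vw vK]; first exact/sym_connect_sym/adj_sym.
    move/existsPn/(_ v)/existsPn/(_ w): none.
    by rewrite LE vw andbT vK /= negbK.
  by move: yL; rewrite LE -(closed_connect cl (conG x y)) xK.
(* The endpoint of smaller absolute value has to be the root on its side; if that is [y], the two
   sides are exchanged and [z] is negated. *)
have [zxy|/ltW zxy] := lerP (z x) (- z y).
  exact: (extremal_cut LE CK CL cK cL eig zK zL' xK yL xy zxy lm).
apply: (extremal_cut (K := L) (L := K) _ CL CK cL cK eigN zL _ yL xK _ _ lm).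
- by move=> w; rewrite LE negbK.
- by move=> w /zK; rewrite oppr_lt0.
- by rewrite adj_sym.
- by rewrite opprK.
Qed.

End Extremal.
End ExtremalClass.

Theorem theorem1p5 (R : realType) (C : sgraph -> Prop) (hC : graph_class C)
  (alpha beta : nat -> R)
  (halpha : forall s : nat, (0 < s)%N -> is_alpha C s (alpha s))
  (hbeta : forall t : nat, (0 < t)%N -> is_beta C t (beta t))
  (hlt : forall s t : nat, (0 < s)%N -> (s < t)%N -> alpha s < beta t)
  (n : nat) (hn0 : (0 < n)%N) (hn : ~~ odd n)
  (Gs : sgraph) (us : Gs)
  (hGsC : C Gs) (hGscard : #|Gs| = n./2)
  (hGsmax : sigma1 (adjmx R Gs - vertex_mx R us) = beta n./2)
  (hGsuniq : forall (G : sgraph) (v : G), C G -> #|G| = n./2 ->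
     sigma1 (adjmx R G - vertex_mx R v) = beta n./2 ->
     rooted_isomorphic v us) :
  let M := adjmx R Gs - vertex_mx R us in
  [/\ exists x : 'cV[R]_#|Gs|, positive_eigenvector M (sigma1 M) x,
      forall x : 'cV[R]_#|Gs|, positive_eigenvector M (sigma1 M) x ->
        forall v : Gs, x (enum_rank us) 0 <= x (enum_rank v) 0
    & forall G : sgraph, C G -> gconnected G -> #|G| = n ->
        rho R 2 G <= beta n./2 /\
        (rho R 2 G = beta n./2 <->
           C (two_copies_plus_edge us us) /\
           isomorphic G (two_copies_plus_edge us us))].
Proof.
move=> M; have hm : (0 < n./2)%N by rewrite -hGscard; apply/card_gt0P; exists us.
(* [f] is used twice: as the positive eigenvector claimed first, and as the test function for the
   converse of the equality case. *)
have [f [f0 fE]] := extremal_eigenvector hC halpha hlt hGsC hGscard hGsmax.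
split.
- exists (\col_i f (enum_val i)); split; last by move=> i; rewrite mxE.
  apply/colP => i; rewrite [in LHS]/M hGsmax adjmx_vertexE !mxE -fE -(wadj_app (fun x => (x == us)%:R)).
  rewrite /kernel_app (reindex _ (onW_bij _ (@enum_val_bij Gs))).
  by apply: eq_bigr => j _; rewrite !mxE.
- move=> x; exact: (extremal_root_min hbeta hGsC hGscard hGsmax).
move=> G CG conG cG.
have cG2 : #|G| = (n./2 + n./2)%N by rewrite cG addnn even_halfK.
have G1 : (1 < #|G|)%N by rewrite cG2; lia.
have [l [z [rl eig pos neg]]] := mixed_sign_eigenvector R conG G1.
have key : beta n./2 <= l -> l = beta n./2 /\ isomorphic G (two_copies_plus_edge us us).
  exact: (extremal_mixed_sign hC halpha hbeta hlt hGscard hGsuniq CG conG cG2 eig pos neg).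
(* Either [beta n./2 <= l], and then [key] gives equality with [l], or [l] is already smaller; in
   both cases [rl] concludes. *)
have rho_le : rho R 2 G <= beta n./2.
  by have [/key[<-]|/ltW/(le_trans rl)] := leP (beta n./2) l.
split=> //; split=> [rE|[_ iso]].
  have [_ iso] : l = beta n./2 /\ isomorphic G (two_copies_plus_edge us us).
    by apply: key; rewrite -rE.
  by split=> //; exact: hC.1 iso CG.
by apply: le_anti; rewrite rho_le (second_eigenvalue_two_copies iso f0 fE).
Qed.
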